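(* Let $\Omega=\{1,\dots,d\}^{\mathbb N}$ with the shift $\sigma$, let $A:\Omega\to\mathbb R$ be Lipschitz continuous, let $h$ be the Peierls barrier of $A$, and let $u:\Omega\to\mathbb R$ be any calibrated subaction for $A$. If $x$ and $z$ are in the same irreducible component of the Aubry set $\mathcal A$, then for any $y\in\Omega$, $$h(x,y)+u(x)=h(z,y)+u(z).$$
   Context: $\Omega$ carries the metric $d(x,y)=2^{-\min\{n:\ x_n\ne y_n\}}$ and $\sigma(x_0x_1x_2\ldots)=x_1x_2\ldots$. $m(A)=\max\int A\,d\nu$ over $\sigma$-invariant Borel probability measures $\nu$. $S_n(f)=f+f\circ\sigma+\dots+f\circ\sigma^{n-1}$. The Peierls barrier is $$h(x,y)=\lim_{\epsilon\to0}\ \limsup_{n\to\infty}\ \sup\{S_n(A-m(A))(z):\ z\in\Omega,\ \sigma^n(z)=y,\ d(x,z)<\epsilon\}\in[-\infty,+\infty).$$ The Mañé potential is $S_A(x,y)=\lim_{\epsilon\to0}\sup\{S_n(A-m(A))(z):\ n\ge1,\ \sigma^n(z)=y,\ d(z,x)<\epsilon\}$, and the Aubry set is $\mathcal A=\{x\in\Omega:\ S_A(x,x)=0\}$. The relation $h(x,y)+h(y,x)=0$ is an equivalence relation on $\mathcal A$; its classes are the irreducible components of $\mathcal A$. A calibrated subaction is a continuous $u:\Omega\to\mathbb R$ with $u(x)=\max_{\sigma(y)=x}[A(y)+u(y)-m(A)]$ for all $x\in\Omega$. *)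

(* Defs.v *)
From HB Require Import structures.
From mathcomp Require Import all_boot all_order all_algebra.
From mathcomp Require Import all_classical all_reals all_analysis.
Set Implicit Arguments.
Unset Strict Implicit.
Unset Printing Implicit Defensive.
Import Order.TTheory GRing.Theory Num.Theory.
Import numFieldNormedType.Exports.
Local Open Scope classical_set_scope.
Local Open Scope ring_scope.

(* The sequence space Omega over an alphabet of d.+1 symbols: the successor
   says that the alphabet is nonempty, as measurable types must be pointed.
   The realType R is a phantom parameter: the metric structure below takes its
   values in R, and the type has to determine it. *)
Definition fullshift (R : realType) (d : nat) : Type := nat -> 'I_d.+1.

HB.instance Definition _ (R : realType) (d : nat) :=
  Choice.copy (fullshift R d) (nat -> 'I_d.+1).

HB.instance Definition _ (R : realType) (d : nat) :=
  isPointed.Build (fullshift R d) (fun=> ord0).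

Section Metric.
Variables (R : realType) (d : nat).
Implicit Types x y z : fullshift R d.

(* 2^-n for the least n with x n != y n, and 0 when there is none *)
Definition shift_dist x y : R :=
  if pselect (exists n, x n != y n) is left e then 2^-1 ^+ ex_minn e else 0.

Lemma shift_distxx x : shift_dist x x = 0.
Proof.
rewrite /shift_dist; case: pselect => // e; exfalso.
by case: e => n; rewrite eqxx.
Qed.

Lemma shift_dist_eq0 x y : shift_dist x y = 0 -> x = y.
Proof.
rewrite /shift_dist; case: pselect => [e /eqP|ne _].
  by rewrite expf_eq0 invr_eq0 pnatr_eq0 andbF.
by apply/funext => n; apply/eqP/negPn/negP => xy; apply: ne; exists n.
Qed.

Lemma shift_dist_sym x y : shift_dist x y = shift_dist y x.
Proof.
rewrite /shift_dist; case: pselect => [e|ne]; case: pselect => [e'|ne'] //.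
- congr (_ ^+ _); case: ex_minnP => i xi mi; case: ex_minnP => j xj mj.
  by apply/eqP; rewrite eqn_leq mi ?mj// eq_sym.
- by exfalso; case: e => n xy; apply: ne'; exists n; rewrite eq_sym.
- by exfalso; case: e' => n xy; apply: ne; exists n; rewrite eq_sym.
Qed.

Lemma shift_dist_ge0 x y : 0 <= shift_dist x y.
Proof. by rewrite /shift_dist; case: pselect => // e; rewrite exprn_ge0// invr_ge0. Qed.

Lemma shift_dist_ge x y n : x n != y n -> 2^-1 ^+ n <= shift_dist x y.
Proof.
move=> xy; rewrite /shift_dist; case: pselect => [e|ne].
  by case: ex_minnP => i _ /(_ _ xy) le_in;
    rewrite ler_wiXn2l// ?invr_ge0// invf_le1// ler1n.
by exfalso; apply: ne; exists n.
Qed.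

Lemma shift_dist_triangle y x z :
  shift_dist x z <= shift_dist x y + shift_dist y z.
Proof.
rewrite {1}/shift_dist; case: pselect => [e|_]; last first.
  by rewrite addr_ge0// shift_dist_ge0.
case: ex_minnP => n xz _; have [xy|xy] := eqVneq (x n) (y n).
  by rewrite -[leLHS]add0r lerD ?shift_dist_ge0// shift_dist_ge// -xy.
by rewrite -[leLHS]addr0 lerD ?shift_dist_ge0// shift_dist_ge.
Qed.

HB.instance Definition _ := @isMetric.Build R (fullshift R d) shift_dist
  shift_distxx shift_dist_eq0 shift_dist_sym shift_dist_triangle.

End Metric.

Definition shift_map (R : realType) (d : nat) (x : fullshift R d) :
  fullshift R d := fun n => x n.+1.

Definition borel_fullshift (R : realType) (d : nat) :=
  g_sigma_algebraType (@open (fullshift R d)).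

Section PeierlsBarrier.
Variables (R : realType) (d : nat).
Local Notation Omega := (fullshift R d).
Local Notation sigma := (@shift_map R d).
Implicit Types (f A u : Omega -> R) (x y z : Omega).

Definition lipschitz_fun f : Prop :=
  exists K : R, forall x y, `|f x - f y| <= K * mdist x y.

Definition invariant_prob (nu : probability (borel_fullshift R d) R) : Prop :=
  forall B : set (borel_fullshift R d), measurable B -> nu (sigma @^-1` B) = nu B.

(* For continuous A the supremum is attained, by weak-* compactness. *)
Definition max_integral A : R :=
  sup [set (\int[nu]_w A w) | nu in invariant_prob].

Definition birkhoff_sum f (n : nat) x : R := \sum_(i < n) f (iter i sigma x).

Definition normalized A : Omega -> R := fun w => A w - max_integral A.

Definition peierls_barrier A x y : \bar R :=
  lim (limn_esup (fun n => ereal_sup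
         [set (birkhoff_sum (normalized A) n z)%:E | z in
            [set z | iter n sigma z = y /\ mdist x z < e]])
       @[e --> (0 : R)^'+]).

Definition mane_potential A x y : \bar R :=
  lim (ereal_sup
         [set s | exists n z, [/\ (1 <= n)%N, iter n sigma z = y, mdist z x < e &
            s = (birkhoff_sum (normalized A) n z)%:E]]
       @[e --> (0 : R)^'+]).

Definition aubry_set A : set Omega := [set x | mane_potential A x x = 0%E].

Definition irreducible_component A (C : set Omega) : Prop :=
  exists2 x, aubry_set A x & C = [set z | aubry_set A z /\
    (peierls_barrier A x z + peierls_barrier A z x = 0)%E].

Definition calibrated_subaction A u : Prop :=
  continuous u /\
  forall x, let values := [set A y + u y - max_integral A | y in
                             [set y | sigma y = x]] in
    values (u x) /\ ubound values (u x).

End PeierlsBarrier.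

(* Main.v *)
Require Import Defs.
From HB Require Import structures.
From mathcomp Require Import all_boot all_order all_algebra.
From mathcomp Require Import all_classical all_reals all_analysis.
From mathcomp Require Import ring lra.
Import Order.TTheory GRing.Theory Num.Theory.
Import numFieldNormedType.Exports.
Local Open Scope classical_set_scope.
Local Open Scope ring_scope.

(* Two inequalities suffice. The barrier is superadditive,
   h(a,b) + h(b,c) <= h(a,c), because orbit segments can be concatenated with
   an error in the Birkhoff sums controlled by the Lipschitz constant; and a
   calibrated subaction dominates it, h(a,b) <= u(b) - u(a). If
   h(w,x) + h(x,w) = 0, the second inequality, used in both directions, forces
   h(w,x) = u(x) - u(w) and h(x,w) = u(w) - u(x); superadditivity then gives
   h(x,y) + u(x) = h(w,y) + u(w) for every y. Two points of a component are
   compared through its base point w. *)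

Lemma limn_esup_inf (R : realType) (v : (\bar R)^nat) :
  limn_esup v = ereal_inf (range (esups v)).
Proof. by rewrite limn_esup_lim; apply/cvg_lim => //; exact: cvg_esups_inf. Qed.

Lemma lee_fin_minorants (R : realType) (a b : \bar R) :
  (forall r : R, r%:E <= a -> r%:E <= b)%E -> (a <= b)%E.
Proof.
case: a => [r|ab|_]; [exact| |exact: leNye].
case: b ab => [s|//|] ab.
- by have := ab (s + 1) (leey _); rewrite lee_fin gerDl ler10.
- by have := ab 0 (leey _).
Qed.

Section Shift.
Context {R : realType} {d : nat}.
Local Notation Omega := (fullshift R d).
Local Notation sigma := (@shift_map R d).
Implicit Types (f A u : Omega -> R) (x y z a b c w : Omega).

Lemma iter_shiftE n x i : iter n sigma x i = x (n + i)%N.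
Proof. by elim: n i => // n IH i; rewrite iterS /shift_map IH addnS. Qed.

Lemma mdist_shift x y : x 0%N = y 0%N ->
  2 * mdist x y <= mdist (sigma x) (sigma y).
Proof.
move=> xy0; rewrite /mdist /= {1}/shift_dist; case: pselect => [e|_]; last first.
  by rewrite mulr0 shift_dist_ge0.
case: ex_minnP => -[|n] xyn _; first by rewrite xy0 eqxx in xyn.
rewrite exprS mulrA divff ?mul1r ?pnatr_eq0//.
exact: shift_dist_ge.
Qed.

Lemma birkhoff_sumS f n x :
  birkhoff_sum f n.+1 x = f x + birkhoff_sum f n (sigma x).
Proof.
rewrite /birkhoff_sum big_ord_recl; congr (_ + _).
by apply: eq_bigr => i _; rewrite /= -iterSr.
Qed.

Lemma birkhoff_sumD f m n x :
  birkhoff_sum f (m + n) x =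
  birkhoff_sum f m x + birkhoff_sum f n (iter m sigma x).
Proof.
elim: m x => [|m IH] x; first by rewrite /birkhoff_sum big_ord0 add0r.
by rewrite addSn !birkhoff_sumS IH addrA iterSr.
Qed.

Lemma mdist_iter_shift n x y : (forall i, (i < n)%N -> x i = y i) ->
  mdist x y <= mdist (iter n sigma x) (iter n sigma y).
Proof.
elim: n x y => // n IH x y xy; rewrite !iterSr.
have /IH : forall i, (i < n)%N -> sigma x i = sigma y i.
  by move=> i ni; exact: (xy i.+1).
have := mdist_shift _ _ (xy 0%N isT); have := mdist_ge0 x y; lra.
Qed.

(* The distance at time 0 is kept on the left-hand side to absorb the geometric
   series of the distances along the orbit. *)
Lemma birkhoff_sum_distortion f (K : R) n x y : 0 <= K ->
  (forall x y, `|f x - f y| <= K * mdist x y) ->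
  (forall i, (i < n)%N -> x i = y i) ->
  `|birkhoff_sum f n x - birkhoff_sum f n y| + K * mdist x y
    <= K * mdist (iter n sigma x) (iter n sigma y).
Proof.
move=> K0 fK; elim: n x y => [|n IH] x y xy.
  by rewrite /birkhoff_sum !big_ord0 subrr normr0 add0r.
rewrite !iterSr !birkhoff_sumS.
have /IH : forall i, (i < n)%N -> sigma x i = sigma y i.
  by move=> i ni; exact: (xy i.+1).
have := ler_wpM2l K0 (mdist_shift _ _ (xy 0%N isT)).
have := fK x y; set s := birkhoff_sum _ _ _; set t := birkhoff_sum _ _ _.
have := ler_normD (f x - f y) (s - t).
rewrite (_ : f x - f y + (s - t) = f x + s - (f y + t)); last by ring.
lra.
Qed.

Definition concat n x y : Omega :=
  fun i => if (i < n)%N then x i else y (i - n)%N.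

Lemma concat_prefix n x y i : (i < n)%N -> concat n x y i = x i.
Proof. by rewrite /concat => ->. Qed.

Lemma iter_shift_concat n x y : iter n sigma (concat n x y) = y.
Proof.
by apply/funext => i; rewrite iter_shiftE /concat ltnNge leq_addr /= addKn.
Qed.

Lemma lipschitz_normalized A : lipschitz_fun A ->
  exists2 K : R, 0 <= K &
    forall x y, `|normalized A x - normalized A y| <= K * mdist x y.
Proof.
case=> K AK; exists `|K| => // x y.
rewrite /normalized opprB addrA subrK (le_trans (AK x y))//.
by rewrite ler_wpM2r ?mdist_ge0 ?ler_norm.
Qed.

Lemma barrier_geP A x y (r : R) :
  (r%:E <= peierls_barrier A x y)%E <->
  forall (e delta : R) (N : nat), 0 < e -> 0 < delta -> exists n z,
    [/\ (N <= n)%N, iter n sigma z = y, mdist x z < e &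
        r - delta < birkhoff_sum (normalized A) n z].
Proof.
pose F (e : R) n := ereal_sup
  [set (birkhoff_sum (normalized A) n z)%:E | z in
     [set z | iter n sigma z = y /\ mdist x z < e]].
have F_homo (e e' : R) n : e <= e' -> (F e n <= F e' n)%E.
  move=> ee'; apply: ereal_sup_le => _ [z [zy xz] <-].
  by exists z => //; split => //; exact: lt_le_trans ee'.
have esups_homo (e e' : R) N : e <= e' -> (esups (F e) N <= esups (F e') N)%E.
  move=> ee'; apply: ge_ereal_sup => _ [n Nn <-].
  by apply: le_trans (F_homo _ _ _ ee') _; apply: ereal_sup_ubound; exists n.
have -> : peierls_barrier A x y =
    ereal_inf [set limn_esup (F e) | e in [set` `]0, +oo[%R]].
  apply/cvg_lim => //; apply: nondecreasing_at_right_cvge => // e e' _ _ ee'.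
  rewrite !limn_esup_inf; apply: le_ereal_inf_tmp => _ [N _ <-].
  apply: le_trans (esups_homo _ _ N ee').
  by apply: ereal_inf_lbound; exists N.
split=> [rh e delta N e0 delta0|near].
  have /lt_le_trans : ((r - delta)%:E < r%:E)%E by rewrite lte_fin gtrBl.
  have rN : (r%:E <= esups (F e) N)%E.
    apply: (le_trans rh); apply: (@le_trans _ _ (limn_esup (F e))).
      by apply: ereal_inf_lbound; exists e => //=; rewrite in_itv/= e0.
    by rewrite limn_esup_inf; apply: ereal_inf_lbound; exists N.
  move=> /(_ _ rN)/ereal_sup_gt[_ [n Nn <-]].
  by move=> /ereal_sup_gt[_ [z [zy xz] <-]]; rewrite lte_fin; exists n, z.
apply: le_ereal_inf_tmp => _ [e /= + <-]; rewrite in_itv/= andbT => e0.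
rewrite limn_esup_inf; apply: le_ereal_inf_tmp => _ [N _ <-].
apply/lee_subgt0Pr => delta delta0.
have [n [z [Nn zy xz rz]]] := near e delta N e0 delta0.
apply: (@le_trans _ _ (F e n)); last by apply: ereal_sup_ubound; exists n.
apply: (@le_trans _ _ (birkhoff_sum (normalized A) n z)%:E).
  by rewrite -EFinB lee_fin ltW.
by apply: ereal_sup_ubound; exists z.
Qed.

Lemma barrier_superadditive A a b c (r s : R) : lipschitz_fun A ->
  (r%:E <= peierls_barrier A a b)%E -> (s%:E <= peierls_barrier A b c)%E ->
  ((r + s)%:E <= peierls_barrier A a c)%E.
Proof.
move=> /lipschitz_normalized[K K0 AK] /barrier_geP rab /barrier_geP sbc.
apply/barrier_geP => e delta N e0 delta0.
have delta4 : 0 < delta / 4 by rewrite divr_gt0.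
have e2 : 0 < e / 2 by rewrite divr_gt0.
pose eta := Num.min (e / 2) (delta / 4 / (K + 1)).
have K1 : 0 < K + 1 by rewrite ltr_wpDl.
have eta0 : 0 < eta by rewrite lt_min e2/= divr_gt0.
have eta_e : eta <= e / 2 by rewrite ge_min lexx.
have Keta : K * eta <= delta / 4.
  have : eta * (K + 1) <= delta / 4 by rewrite -ler_pdivlMr// ge_min lexx orbT.
  lra.
have [n [z1 [Nn z1b az1 rz1]]] := rab (e / 2) (delta / 4) N e2 delta4.
have [m [z2 [_ z2c bz2 sz2]]] := sbc eta (delta / 4) 0%N eta0 delta4.
pose z := concat n z1 z2.
have z1z i : (i < n)%N -> z1 i = z i by move=> ni; rewrite /z concat_prefix.
have zz2 : iter n sigma z = z2 by exact: iter_shift_concat.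
exists (n + m)%N, z; split.
- exact: leq_trans Nn (leq_addr _ _).
- by rewrite addnC iterD zz2.
- have := metric_triangle a z1 z; have := mdist_iter_shift _ _ _ z1z.
  rewrite zz2 z1b; lra.
- have := birkhoff_sum_distortion _ _ _ _ _ K0 AK z1z.
  rewrite birkhoff_sumD zz2 z1b.
  have := ler_wpM2l K0 (ltW bz2).
  have := mulr_ge0 K0 (mdist_ge0 z1 z).
  have := ler_norm
    (birkhoff_sum (normalized A) n z1 - birkhoff_sum (normalized A) n z).
  lra.
Qed.

Lemma birkhoff_sum_le_subaction A u n x : calibrated_subaction A u ->
  birkhoff_sum (normalized A) n x <= u (iter n sigma x) - u x.
Proof.
move=> [_ uA]; elim: n x => [|n IH] x.
  by rewrite /birkhoff_sum big_ord0 subrr.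
rewrite iterSr birkhoff_sumS.
have : normalized A x + u x <= u (sigma x).
  by rewrite /normalized addrAC; apply: (uA (sigma x)).2; exists x.
have := IH (sigma x); lra.
Qed.

Lemma barrier_le_subaction A u a b : calibrated_subaction A u ->
  (peierls_barrier A a b <= (u b - u a)%:E)%E.
Proof.
move=> uA; apply: lee_fin_minorants => r /barrier_geP rab.
rewrite lee_fin; apply/ler_addgt0Pr => delta delta0.
have delta2 : 0 < delta / 2 by rewrite divr_gt0.
have /cvgrPdist_lt/(_ _ delta2) := uA.1 a.
move=> /nbhs_ballP[e e0 ae].
have [n [z [_ zb az rz]]] := rab e (delta / 2) 0%N e0 delta2.
have : `|u a - u z| < delta / 2 by apply: ae; rewrite ballEmdist.
have := birkhoff_sum_le_subaction _ _ n z uA; rewrite zb.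
have := ler_norm (u a - u z); lra.
Qed.

Lemma barrier_eq_subaction A u a b : calibrated_subaction A u ->
  (peierls_barrier A a b + peierls_barrier A b a = 0)%E ->
  peierls_barrier A a b = (u b - u a)%:E.
Proof.
move=> uA; have := barrier_le_subaction A u a b uA.
have := barrier_le_subaction A u b a uA.
case: (peierls_barrier A a b) => [r||];
  case: (peierls_barrier A b a) => [s||] //.
by rewrite !lee_fin -EFinD => su ru [] rs; congr EFin; lra.
Qed.

Lemma barrier_cohomologous_le A u x z y :
  lipschitz_fun A -> calibrated_subaction A u ->
  (peierls_barrier A x z + peierls_barrier A z x = 0)%E ->
  (peierls_barrier A z y + (u z)%:E <= peierls_barrier A x y + (u x)%:E)%E.
Proof.
move=> Alip uA xz; rewrite -leeBlDr//; apply: lee_fin_minorants => r.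
rewrite leeBrDr// => rzy.
have {}rzy : ((r + u x - u z)%:E <= peierls_barrier A z y)%E.
  by rewrite EFinB leeBlDr.
have hxz : ((u z - u x)%:E <= peierls_barrier A x z)%E.
  by rewrite (barrier_eq_subaction _ _ _ _ uA xz).
have := barrier_superadditive _ _ _ _ _ _ Alip hxz rzy.
by congr (_%:E <= _)%E; ring.
Qed.

End Shift.

Theorem theorem4p8 (R : realType) (d : nat) (A u : fullshift R d -> R)
    (A_lipschitz : lipschitz_fun A) (u_calibrated : calibrated_subaction A u)
    (C : set (fullshift R d)) (C_component : irreducible_component A C)
    (x z : fullshift R d) (Cx : C x) (Cz : C z) (y : fullshift R d) :
  (peierls_barrier A x y + (u x)%:E = peierls_barrier A z y + (u z)%:E)%E.
Proof.
have [w _ Cw] := C_component.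
suff base v : C v ->
    (peierls_barrier A v y + (u v)%:E = peierls_barrier A w y + (u w)%:E)%E.
  by rewrite (base _ Cx) (base _ Cz).
rewrite Cw => -[_ wv]; apply/eqP; rewrite eq_le; apply/andP; split.
- exact: barrier_cohomologous_le.
- by apply: barrier_cohomologous_le => //; rewrite addeC.
Qed.
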